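(* For every $\beta\in(1,2)$ there exists a constant $c(\beta)>0$ such that for Lebesgue almost all $x\in\left(0,\frac{1}{\beta-1}\right)$, \[ \liminf_{n\to\infty}\frac{\log\big(\mathcal N_n(x;\beta)\big)}{n}\ge c(\beta). \]
   Context: For $\beta\in(1,2)$ let $I_\beta:=\left[0,\frac{1}{\beta-1}\right]$. A $\beta$-expansion of $x\in I_\beta$ is a sequence $(x_i)_{i\ge1}\in\{0,1\}^{\mathbb N}$ with $x=\sum_{i=1}^\infty x_i\beta^{-i}$. For $n\in\mathbb N$ put \[ \mathcal E^n_\beta(x):=\Big\{(x_1,\dots,x_n)\in\{0,1\}^n : \exists (x_{n+1},x_{n+2},\dots)\in\{0,1\}^{\mathbb N}\text{ with } x=\sum_{k=1}^\infty x_k\beta^{-k}\Big\}, \] and $\mathcal N_n(x;\beta):=|\mathcal E^n_\beta(x)|$, the number of words of length $n$ that can be extended to $\beta$-expansions of $x$. *)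

(* Defs.v *)
From mathcomp Require Import all_boot all_order all_algebra.
From mathcomp Require Import all_classical all_reals all_analysis.

Set Implicit Arguments.
Unset Strict Implicit.
Unset Printing Implicit Defensive.

Import Order.TTheory GRing.Theory Num.Theory.
Import numFieldNormedType.Exports.

Local Open Scope classical_set_scope.
Local Open Scope ring_scope.

(* Digit sequences are indexed from 0: [e k] is the digit $x_{k+1}$, which has
   weight $\beta^{-(k+1)}$. *)
Definition beta_expansion (R : realType) (beta x : R) (e : nat -> bool) : Prop :=
  series (fun k : nat => (e k)%:R * beta ^- k.+1) @ \oo --> x.

Definition beta_words (R : realType) (beta x : R) (n : nat) :
    {set n.-tuple bool} :=
  [set w : n.-tuple bool | `[< exists e : nat -> bool,
     (forall i : 'I_n, e i = tnth w i) /\ beta_expansion beta x e >]]%SET.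

Definition beta_count (R : realType) (beta x : R) (n : nat) : nat :=
  #|beta_words beta x n|.

(* Main.v *)
Require Import Defs.
From mathcomp Require Import all_boot all_order all_algebra.
From mathcomp Require Import all_classical all_reals all_analysis.
From mathcomp Require Import measurable_realfun ring lra.

(** Why the theorem holds.  Write M = 1/(beta-1), and N_n(x) for the number of
    words of length n that extend to an expansion of x.  Putting a digit in
    front of an expansion gives N_{n+1}(x) >= N_n(beta x) + N_n(beta x - 1)
    ([beta_countS]), where a term vanishes when its argument leaves [0, M].  Any
    split of a unit mass between the two digits turns this into an upper bound
    on the reciprocal, since
      1/(a+b) <= e^2/a + (1-e)^2/b                            ([inv_add_le]).
    Hence 1/N_n <= F_n, where F_0 = 1 and F_{n+1} = L F_n for the linear operator
      L f (x) = q0(beta x) f(beta x) + q1(beta x - 1) f(beta x - 1),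
    with weight 1 where the digit is forced, and weights eps^2 and (1-eps)^2 for
    the digits 0 and 1 where both are possible ([inv_beta_count_le]).

    It remains to show that F_n is exponentially small almost everywhere.  The
    dual of L with respect to Lebesgue measure is the transfer operator
      P g (y) = (q0(y) g(y/beta) + q1(y) g((y+1)/beta)) / beta,
    and it is enough to find a bounded g, bounded away from 0 on [0, M] and zero
    outside, with P g <= rho g for some rho < 1 ([exists_potential]): then
    int F_n g <= rho^n int g, and Markov's inequality and the Borel-Cantelli
    lemma give F_n(x) <= rho^(n/2), hence N_n(x) >= rho^(-n/2), for almost every
    x in (0, M) and all large n.  The constant is c = - (ln rho) / 2.

    To build g, note that P is for eps = 0 the transfer operator of the greedy
    map, whose invariant density on [0, 1) is Parry's function, the sum of
    beta^-n [y < r_n] with r_n the greedy orbit of 1.  A small eps > 0 has two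
    effects.  The weight (1-eps)^2 < 1 makes P lose a mass of order eps, but only
    on [0, M - 1], the points that the digit 1 reaches from the region of choice.
    And the digit 0, which the greedy map never uses there, sends a mass of order
    eps^2 to [1, M], where P divides the density by beta at each step, and from
    there back to [0, 1).  The gain is thus of a smaller order than the loss, but
    the loss is localised.  It is spread over [0, 1) by subtracting from Parry's
    function a small multiple of a function v, a large negative power capped near
    0: y/beta is a preimage of y, so P v >= 2 v away from 0, and subtracting v
    gives a strict decrease where the loss may be absent.  The inequality for
    the resulting function is [potential_transfer]. *)

Set Implicit Arguments.
Unset Strict Implicit.
Unset Printing Implicit Defensive.

Import Order.TTheory GRing.Theory Num.Theory.
Import numFieldNormedType.Exports.

Local Open Scope classical_set_scope.
Local Open Scope ring_scope.

(** * Greedy expansions and the recursion for the number of words *)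

(** The orbit of [y] under the map that takes the digit 1 as soon as possible.
    For [y = 1] it is the orbit that defines Parry's density. *)
Fixpoint greedy {R : realType} (beta y : R) (n : nat) : R :=
  if n is n'.+1 then
    beta * greedy beta y n' - (1 <= beta * greedy beta y n')%R%:R
  else y.

Definition greedy_digit {R : realType} (beta y : R) (n : nat) : bool :=
  (1 <= beta * greedy beta y n)%R.

Lemma series_greedy_digit (R : realType) (beta y : R) (n : nat) : 0 < beta ->
  series (fun k => (greedy_digit beta y k)%:R * beta ^- k.+1) n =
  y - greedy beta y n * beta ^- n.
Proof.
move=> b0; elim: n => [|n IH].
  by rewrite /series/= big_geq// expr0 invr1 mulr1 subrr.
rewrite seriesSr IH /greedy_digit /= exprS.
have bn : beta ^+ n != 0 by rewrite expf_neq0// gt_eqF.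
by case: leP => _ /=; field; rewrite bn gt_eqF.
Qed.

Lemma greedy_itv (R : realType) (beta y : R) (n : nat) :
  1 < beta -> beta < 2 -> 0 <= y -> y <= (beta - 1)^-1 ->
  0 <= greedy beta y n <= (beta - 1)^-1.
Proof.
move=> b1 b2 y0 yM; elim: n => [|n /andP[z0 zM]] /=; first by rewrite y0.
have b10 : 0 < beta - 1 by rewrite subr_gt0.
have M1 : 1 < (beta - 1)^-1 by rewrite invf_gt1//; lra.
set M := (beta - 1)^-1 in zM M1 *; set z := greedy beta y n in z0 zM *.
have hM : beta * M = M + 1 by rewrite /M; field; rewrite gt_eqF.
have zb : beta * z <= beta * M by rewrite ler_pM2l//; lra.
have z0b : 0 <= beta * z by rewrite mulr_ge0//; lra.
by case: (leP 1 (beta * z)) => h; rewrite ?(mulr1n, mulr0n); apply/andP; split; lra.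
Qed.

Lemma cvg_pow_inv (R : realType) (beta : R) : 1 < beta ->
  (fun n => beta ^- n) @ \oo --> (0 : R).
Proof.
move=> b1; rewrite (_ : (fun n => _) = (fun n => beta^-1 ^+ n)); last first.
  by apply/funext => n; rewrite exprVn.
apply: cvg_expr; rewrite normrV ?unitfE ?gt_eqF//; last by lra.
by rewrite gtr0_norm ?invf_lt1//; lra.
Qed.

(** The remainder after [n] digits is the [n]-th point of the orbit divided by
    [beta ^+ n], and the orbit is bounded by [greedy_itv]. *)
Lemma beta_expansion_greedy (R : realType) (beta y : R) :
  1 < beta -> beta < 2 -> 0 <= y -> y <= (beta - 1)^-1 ->
  beta_expansion beta y (greedy_digit beta y).
Proof.
move=> b1 b2 y0 yM; have b0 : 0 < beta by lra.
rewrite /beta_expansion.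
rewrite (_ : series _ = fun n => y - greedy beta y n * beta ^- n); last first.
  by apply/funext => n; exact: series_greedy_digit.
rewrite -[X in _ --> X]subr0; apply: cvgB; first exact: cvg_cst.
have h0 : (fun n => (beta - 1)^-1 * beta ^- n) @ \oo --> (0 : R).
  rewrite -(mulr0 (beta - 1)^-1); apply: cvgM; first exact: cvg_cst.
  exact: cvg_pow_inv.
apply: (squeeze_cvgr _ (cvg_cst 0) h0).
apply: nearW => n; have /andP[g0 gM] := greedy_itv n b1 b2 y0 yM.
have bn : 0 <= beta ^- n by rewrite invr_ge0 exprn_ge0// ltW.
by rewrite mulr_ge0//= ler_wpM2r.
Qed.

Lemma beta_expansion_cons (R : realType) (beta x : R) (d : bool)
    (e : nat -> bool) : 0 < beta ->
  beta_expansion beta (beta * x - d%:R) e ->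
  beta_expansion beta x (fun n => if n is n'.+1 then e n' else d).
Proof.
move=> b0 he; rewrite /beta_expansion -cvg_shiftS /=.
set u := fun k : nat => (e k)%:R * beta ^- k.+1.
rewrite (_ : (fun n => _) = fun n => beta^-1 * (d%:R + series u n)).
  have -> : x = beta^-1 * (d%:R + (beta * x - d%:R)) by field; rewrite gt_eqF.
  by apply: cvgM; [exact: cvg_cst|apply: cvgD => //; exact: cvg_cst].
apply/funext => n; rewrite /series/= big_nat_recl//= mulrDr expr1 mulr_sumr.
rewrite mulrC; congr (_ + _); apply: eq_bigr => k _.
by rewrite /u [RHS]mulrCA -invfM -exprS.
Qed.

(** If [e] is an expansion of [beta * x - d], then [d] followed by [e] is one of
    [x].  The words obtained for [d = 0] and for [d = 1] are distinct. *)
Lemma beta_countS (R : realType) (beta x : R) (n : nat) : 0 < beta ->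
  (beta_count beta (beta * x)%R n + beta_count beta (beta * x - 1)%R n <=
   beta_count beta x n.+1)%N.
Proof.
move=> b0.
pose c d (w : n.-tuple bool) : n.+1.-tuple bool := cons_tuple d w.
have cI d : injective (c d) by move=> v w [/val_inj].
have sub d : (c d @: beta_words beta (beta * x - d%:R) n
    \subset beta_words beta x n.+1)%SET.
  apply/fintype.subsetP => _ /imsetP[w hw ->].
  move: hw; rewrite !inE => -[e [ew he]]; exists (fun n => if n is n'.+1 then e n' else d).
  split; last exact: beta_expansion_cons.
  move=> i; case: (unliftP ord0 i) => [j|] ->; first by rewrite tnthS lift0 ew.
  by rewrite tnth0.
rewrite /beta_count -(card_imset _ (cI false)) -(card_imset _ (cI true)).
have := sub false; have := sub true; rewrite subr0 => s1 s0.
rewrite -cardsUI [X in (_ + X)%N](_ : _ = 0%N) ?addn0; last first.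
  apply/eqP; rewrite cards_eq0; apply/eqP/setP => w; rewrite !inE.
  by apply/negP => /andP[/imsetP[v _ ->] /imsetP[v' _ []]].
by apply: subset_leq_card; rewrite finset.subUset s0.
Qed.

(** Starts the induction of [inv_beta_count_le]: the empty word counts because
    every point of the interval has an expansion, for instance the greedy one. *)
Lemma beta_count0_gt0 (R : realType) (beta x : R) :
  1 < beta -> beta < 2 -> 0 <= x -> x <= (beta - 1)^-1 ->
  (0 < beta_count beta x 0)%N.
Proof.
move=> b1 b2 x0 xM; apply/card_gt0P; exists [tuple]; rewrite !inE.
exists (greedy_digit beta x); split; first by case.
exact: beta_expansion_greedy.
Qed.

(** * Parry's density *)

(** Partial sum of Parry's invariant density for the greedy map.  A partial sum
    is only invariant up to an error [beta ^- N], which the strict decrease of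
    [potential] absorbs. *)
Definition parry_sum {R : realType} (beta : R) (N : nat) (y : R) : R :=
  \sum_(0 <= n < N) (y < greedy beta 1 n)%R%:R * beta ^- n.

Lemma greedy1_itv (R : realType) (beta : R) (n : nat) :
  1 < beta -> beta < 2 -> 0 <= greedy beta 1 n <= 1.
Proof.
move=> b1 b2; elim: n => [|n /andP[z0 z1]] /=; first by rewrite ler01 lexx.
set z := greedy beta 1 n in z0 z1 *.
have z0b : 0 <= beta * z by rewrite mulr_ge0//; lra.
have zb : beta * z <= beta by rewrite ler_piMr//; lra.
by case: (leP 1 (beta * z)) => h; rewrite ?(mulr1n, mulr0n); apply/andP; split; lra.
Qed.

Lemma parry_sum_ge1 (R : realType) (beta y : R) (N : nat) :
  0 < beta -> y < 1 -> 1 <= parry_sum beta N.+1 y.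
Proof.
move=> b0 y1; rewrite /parry_sum big_nat_recl//= y1 expr0 invr1 mulr1 lerDl.
by apply: sumr_ge0 => n _; rewrite mulr_ge0// invr_ge0 exprn_ge0// ltW.
Qed.

Lemma parry_sum_ge0 (R : realType) (beta y : R) (N : nat) :
  0 < beta -> 0 <= parry_sum beta N y.
Proof.
move=> b0.
by apply: sumr_ge0 => n _; rewrite mulr_ge0// invr_ge0 exprn_ge0// ltW.
Qed.

Lemma parry_sum_le (R : realType) (beta y : R) (N : nat) :
  1 < beta -> parry_sum beta N y <= beta / (beta - 1).
Proof.
move=> b1; have b0 : 0 < beta by lra.
have b10 : 0 < beta - 1 by lra.
apply: (@le_trans _ _ (beta / (beta - 1) * (1 - beta ^- N))).
  elim: N => [|N IH]; rewrite /parry_sum.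
    by rewrite big_geq// expr0 invr1 subrr mulr0.
  rewrite big_nat_recr//= -/(parry_sum beta N y) exprS.
  have bN : 0 < beta ^+ N by rewrite exprn_gt0.
  apply: (le_trans (lerD IH (ler_wpM2r _ (_ : _ <= 1)))).
  - by rewrite invr_ge0 ltW.
  - by case: (y < _)%R.
  - rewrite le_eqVlt; apply/orP; left; apply/eqP.
    by field; rewrite !gt_eqF.
rewrite ler_piMr ?divr_ge0 ?(ltW b0) ?(ltW b10)// gerBl.
by rewrite invr_ge0 exprn_ge0// ltW.
Qed.

(** Each indicator of [y < r] is sent by the transfer operator to the indicator
    of [y < r'], where [r'] is the image of [r] under the greedy map, plus the
    digit of [r]; so the sum over the orbit of 1 telescopes. *)
Lemma parry_sum_transfer (R : realType) (beta y : R) (N : nat) :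
  1 < beta -> beta < 2 -> 0 <= y -> y < 1 ->
  parry_sum beta N (y / beta) + parry_sum beta N ((y + 1) / beta) =
  beta * (parry_sum beta N y +
    beta ^- N * ((y < greedy beta 1 N)%R%:R - greedy beta 1 N)).
Proof.
move=> b1 b2 y0 y1; have b0 : 0 < beta by lra.
elim: N => [|N IH]; rewrite /parry_sum.
  by rewrite !big_geq//= y1 subrr !(mulr0, addr0).
rewrite !big_nat_recr//= -!/(parry_sum beta N _) addrACA IH -mulrDl exprS.
have := greedy1_itv N b1 b2; set r := greedy beta 1 N => /andP[r0 r1].
rewrite !ltr_pdivrMr// [r * beta]mulrC.
have bN : beta ^+ N != 0 by rewrite expf_neq0// gt_eqF.
have -> : ((y < beta * r)%R%:R + (y + 1 < beta * r)%R%:R : R) =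
    (1 <= beta * r)%R%:R + (y < beta * r - (1 <= beta * r)%R%:R)%R%:R.
  (* If the digit of r is 1, the first indicator is constantly 1 on [0, 1);
     otherwise the second one vanishes there. *)
  rewrite -ltrBrDr; case: (leP 1 (beta * r)) => h.
    by rewrite (_ : y < beta * r)//; lra.
  by rewrite (_ : (y < beta * r - 1) = false) ?subr0 1?addrC//; lra.
by field; rewrite bN gt_eqF.
Qed.

Lemma exists_expr_gt (R : realType) (beta A : R) :
  1 < beta -> exists n, A < beta ^+ n.
Proof.
move=> b1; have [A1|A1] := ltP A 1; first by exists 0%N.
have A0 : 0 < A^-1 by rewrite invr_gt0; lra.
have [n _ hn] := (cvgr_lt _ (cvg_pow_inv b1)) _ A0.
exists n; have := hn n (leqnn n).
by rewrite /= ltf_pV2// posrE ?exprn_gt0//; lra.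
Qed.

(** * A function that the weighted transfer operator strictly decreases *)

(** The weights are functions of the point [y] that is reached, which is the form
    that the transfer operator needs: [digit0_weight] belongs to the step from
    [y / beta] and [digit1_weight] to the step from [(y + 1) / beta].  Both digits
    are possible at [y / beta] for [1 <= y <= (beta - 1)^-1], and both are possible
    at [(y + 1) / beta] for [1 <= y + 1 <= (beta - 1)^-1].  The squares come from
    [inv_add_le]. *)
Definition digit0_weight {R : realType} (beta eps y : R) : R :=
  if y < 1 then 1 else if y <= (beta - 1)^-1 then eps ^+ 2 else 0.

Definition digit1_weight {R : realType} (beta eps y : R) : R :=
  if y < 0 then 0 else if y + 1 <= (beta - 1)^-1 then (1 - eps) ^+ 2 else 1.

Lemma digit1_weight_itv (R : realType) (beta eps y : R) :
  0 <= eps -> eps <= 1 -> 0 <= digit1_weight beta eps y <= 1.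
Proof.
move=> e0 e1; rewrite /digit1_weight; case: ifP => _; first by rewrite lexx ler01.
case: ifP => _; last by rewrite ler01 lexx.
by apply/andP; split; [exact: sqr_ge0|nra].
Qed.

(** The exponent is negative: this is [y] to the power [- s], with [y] replaced by
    [a] below [a] to stay bounded. *)
Definition capped_power {R : realType} (a : R) (s : nat) (y : R) : R :=
  (Num.max y a)^-1 ^+ s.

Lemma capped_power_le (R : realType) (a y : R) (s : nat) :
  0 < a -> capped_power a s y <= a^-1 ^+ s.
Proof.
move=> a0; have ma : a <= Num.max y a by rewrite le_max lexx orbT.
have m0 : 0 < Num.max y a by exact: lt_le_trans ma.
by rewrite /capped_power lerXn2r ?nnegrE ?invr_ge0 ?(ltW a0) ?(ltW m0)// lef_pV2.
Qed.

Lemma capped_power_ge1 (R : realType) (a y : R) (s : nat) :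
  0 < a -> a <= 1 -> y <= 1 -> 1 <= capped_power a s y.
Proof.
move=> a0 a1 y1; have ma : a <= Num.max y a by rewrite le_max lexx orbT.
have m0 : 0 < Num.max y a by exact: lt_le_trans ma.
by rewrite /capped_power exprn_ege1// invf_ge1// ge_max y1 a1.
Qed.

(** With [beta ^+ s] large, the preimage [y / beta] alone makes the transfer
    operator expand the capped power beyond the cap. *)
Lemma capped_power_div (R : realType) (beta a y : R) (s : nat) :
  1 < beta -> 0 < a -> beta * a <= y ->
  capped_power a s (y / beta) = beta ^+ s * capped_power a s y.
Proof.
move=> b1 a0 hy; have b0 : 0 < beta by lra.
have ay : a < y by apply: lt_le_trans hy; rewrite ltr_pMl.
rewrite /capped_power !max_l ?(ltW ay)//; last by rewrite ler_pdivlMr// mulrC.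
by rewrite -exprMn invfM invrK mulrC.
Qed.

(** Parry's density with a capped power subtracted on [0, 1), extended by a small
    constant to [1, (beta - 1)^-1], which the greedy map never enters from
    [0, 1). *)
Definition potential {R : realType} (beta a delta eta : R) (N s : nat) (y : R)
    : R :=
  if y < 0 then 0
  else if y < 1 then parry_sum beta N y - delta * capped_power a s y
  else if y <= (beta - 1)^-1 then eta else 0.

Lemma capped_power_ge0 (R : realType) (a y : R) (s : nat) :
  0 < a -> 0 <= capped_power a s y.
Proof. by move=> a0; rewrite exprn_ge0// invr_ge0 le_max (ltW a0) orbT. Qed.

Lemma potential_le (R : realType) (beta a delta eta : R) (N s : nat) (y : R) :
  0 < beta -> 0 < a -> 0 <= delta -> 0 <= eta ->
  potential beta a delta eta N s y <= parry_sum beta N y + eta.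
Proof.
move=> b0 a0 d0 eta0; rewrite /potential; have := parry_sum_ge0 y N b0.
have : 0 <= delta * capped_power a s y by rewrite mulr_ge0// capped_power_ge0.
by case: ifP => _; [|case: ifP => _; [|case: ifP => _]]; lra.
Qed.

(** The last three inequalities are the balance of masses.  The first says that
    on [beta * a, 1) the decrease of order [delta] due to the capped power exceeds
    the defect [1 - rho], the truncation error and the mass [eta] that comes from
    [1, (beta - 1)^-1].  The second says that on [0, beta * a) the loss of order
    [eps] of the weight [(1 - eps) ^+ 2] exceeds [delta] times the maximal value
    of the capped power.  The third says that on [1, (beta - 1)^-1] the contraction
    by [beta] makes up for the mass of order [eps ^+ 2] sent there by the
    digit 0. *)
Lemma potential_transfer (R : realType) (beta eps rho a delta eta : R)
    (N s : nat) (y : R) :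
  1 < beta -> beta < 2 -> 0 <= eps -> eps <= 1 -> rho <= 1 ->
  0 < a -> beta * a <= beta - 1 -> beta * a + 1 <= (beta - 1)^-1 ->
  2 * beta <= beta ^+ s -> 0 <= delta -> 0 <= eta ->
  (1 - rho) * (beta / (beta - 1)) + beta ^- N.+1 + eta <= delta ->
  beta * (1 + a^-1 ^+ s) * delta <= eps ->
  eps ^+ 2 * (beta / (beta - 1)) + eta <= beta * rho * eta ->
  let g := potential beta a delta eta N.+1 s in
  digit0_weight beta eps y * g (y / beta) +
  digit1_weight beta eps y * g ((y + 1) / beta) <= beta * rho * g y.
Proof.
move=> b1 b2 e0 e1 r1 a0 aB aM bs d0 eta0 delta_ge delta_le eta_ge /=.
set g := potential beta a delta eta N.+1 s.
set H := parry_sum beta N.+1; set v := capped_power a s.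
have b0 : 0 < beta by lra.
have M1 : 1 < (beta - 1)^-1 by rewrite invf_gt1//; lra.
have H0 z : 0 <= H z by exact: parry_sum_ge0.
have HC z : H z <= beta / (beta - 1) by exact: parry_sum_le.
have v0 z : 0 <= v z by exact: capped_power_ge0.
have g_le z : g z <= H z + eta by exact: potential_le.
have trans : 0 <= y -> y < 1 ->
    H (y / beta) + H ((y + 1) / beta) <= beta * H y + beta * beta ^- N.+1.
  move=> y0 y1; rewrite parry_sum_transfer// mulrDr lerD2l ler_pM2l//.
  have /andP[r0 _] := greedy1_itv N.+1 b1 b2.
  rewrite ler_piMr ?invr_ge0 ?exprn_ge0 ?(ltW b0)//.
  by case: (y < _)%R; rewrite ?(mulr1n, mulr0n); lra.
have /andP[w0 w1] := digit1_weight_itv beta y e0 e1.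
have [yneg|y0] := ltP y 0.
  have yb : y / beta < 0 by rewrite ltr_pdivrMr// mul0r.
  by rewrite /digit1_weight /g /potential yneg yb !(mulr0, mul0r) addr0.
have yb0 : (y / beta < 0) = false by apply/negbTE; rewrite -leNgt divr_ge0// ltW.
have yb0' : ((y + 1) / beta < 0) = false.
  by apply/negbTE; rewrite -leNgt divr_ge0//; lra.
have y0' : (y < 0) = false by lra.
have C0 := le_trans (H0 0) (HC 0).
have bN : 0 < beta ^- N.+1 by rewrite invr_gt0 exprn_gt0.
have [y1|y1] := ltP y 1.
  have a1 : a <= 1 by nra.
  have yb : y / beta < 1 by rewrite ltr_pdivrMr//; lra.
  have vy1 : 1 <= v y by apply: capped_power_ge1 => //; exact: ltW.
  have vV : v y <= a^-1 ^+ s by exact: capped_power_le.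
  have tr := trans y0 y1.
  have HCy : H y <= beta / (beta - 1) by exact: HC.
  have rC : (1 - rho) * H y <= (1 - rho) * (beta / (beta - 1)).
    by rewrite ler_wpM2l// subr_ge0.
  have -> : digit0_weight beta eps y = 1 by rewrite /digit0_weight y1.
  have -> : g y = H y - delta * v y by rewrite /g /potential y0' y1.
  have gyb : g (y / beta) = H (y / beta) - delta * v (y / beta).
    by rewrite /g /potential yb0 yb.
  rewrite mul1r gyb.
  have [yt|yt] := leP (beta * a) y.
    (* Away from 0 the weight of the digit 1 may be 1, and the decrease comes from
       the expansion of the capped power. *)
    have -> : v (y / beta) = beta ^+ s * v y by exact: capped_power_div.
    have le1 : digit1_weight beta eps y * g ((y + 1) / beta) <=
        H ((y + 1) / beta) + eta.
      apply: (le_trans (ler_wpM2l w0 (g_le _))).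
      by rewrite ler_piMl// addr_ge0.
    have : beta * delta <= beta * (delta * v y) by rewrite ler_pM2l// ler_peMr.
    have : 2 * beta * (delta * v y) <= beta ^+ s * (delta * v y).
      by rewrite ler_wpM2r// mulr_ge0.
    have : beta * rho * (delta * v y) <= beta * (delta * v y).
      by rewrite ler_wpM2r ?mulr_ge0// ler_piMr// ltW.
    have : eta <= beta * eta by rewrite ler_peMl// ltW.
    move=> eta1 rv sv dv.
    have dlt : beta * ((1 - rho) * H y + beta ^- N.+1 + eta) <= beta * delta.
      by rewrite ler_pM2l//; lra.
    lra.
  (* Near 0 both digits are possible at (y + 1) / beta, which lies in [0, 1) where
     Parry's density is at least 1, so that a mass eps is lost. *)
  have yb1 : (y + 1) / beta < 1 by rewrite ltr_pdivrMr//; lra.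
  have -> : digit1_weight beta eps y = (1 - eps) ^+ 2.
    by rewrite /digit1_weight y0' (_ : y + 1 <= _)//; lra.
  have -> : g ((y + 1) / beta) = H ((y + 1) / beta) - delta * v ((y + 1) / beta).
    by rewrite /g /potential yb0' yb1.
  have H1 : 1 <= H ((y + 1) / beta) by exact: parry_sum_ge1.
  have dv : 0 <= delta * v (y / beta) by rewrite mulr_ge0.
  have dv' : 0 <= delta * v ((y + 1) / beta) by rewrite mulr_ge0.
  have loss : (1 - eps) ^+ 2 *
      (H ((y + 1) / beta) - delta * v ((y + 1) / beta)) <=
      H ((y + 1) / beta) - eps.
    apply: (@le_trans _ _ ((1 - eps) * H ((y + 1) / beta))); last by nra.
    apply: (@le_trans _ _ ((1 - eps) ^+ 2 * H ((y + 1) / beta))).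
      by rewrite ler_wpM2l ?sqr_ge0//; lra.
    by rewrite ler_wpM2r ?H0// expr2 ler_piMl//; lra.
  have dvy : beta * rho * (delta * v y) <= beta * (delta * a^-1 ^+ s).
    apply: (@le_trans _ _ (beta * (delta * v y))).
      by rewrite ler_wpM2r ?mulr_ge0// ler_piMr// ltW.
    by rewrite ler_pM2l// ler_wpM2l.
  have dlt : beta * ((1 - rho) * H y + beta ^- N.+1) <= beta * delta.
    by rewrite ler_pM2l//; lra.
  lra.
have y1' : (y < 1) = false by lra.
have yb1' : ((y + 1) / beta < 1) = false.
  by apply/negbTE; rewrite -leNgt ler_pdivlMr//; lra.
have [yM|yM] := leP y (beta - 1)^-1; last first.
  have ybM : ((y + 1) / beta <= (beta - 1)^-1) = false.
    apply/negbTE; rewrite -ltNge ltr_pdivlMr//.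
    rewrite (_ : _ * beta = (beta - 1)^-1 + 1); first by lra.
    by field; rewrite subr_eq0 gt_eqF.
  have yM' : (y <= (beta - 1)^-1) = false by rewrite leNgt yM.
  rewrite /digit0_weight /g /potential y0' y1' yb0' yb1' ybM yM'.
  by rewrite !(mul0r, mulr0) addr0.
have -> : g y = eta by rewrite /g /potential y0' y1' yM.
have -> : digit0_weight beta eps y = eps ^+ 2 by rewrite /digit0_weight y1' yM.
have g1 : g ((y + 1) / beta) <= eta.
  by rewrite /g /potential yb0' yb1'; case: ifP.
have etaC : eta <= beta / (beta - 1).
  have V0 : 0 <= a^-1 ^+ s by rewrite exprn_ge0// invr_ge0 ltW.
  have rC : 0 <= (1 - rho) * (beta / (beta - 1)) by rewrite mulr_ge0// subr_ge0.
  have C1 : 1 <= beta / (beta - 1) by rewrite ler_pdivlMr//; lra.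
  have dd : delta <= beta * (1 + a^-1 ^+ s) * delta.
    by rewrite ler_peMl// mulr_ege1//; lra.
  lra.
have g0 : g (y / beta) <= beta / (beta - 1).
  rewrite /g /potential yb0; case: ifP => _; last by case: ifP.
  have := HC (y / beta); have : 0 <= delta * v (y / beta) by rewrite mulr_ge0.
  by rewrite /H /v; lra.
have h1 : digit1_weight beta eps y * g ((y + 1) / beta) <= eta.
  by apply: (le_trans (ler_wpM2l w0 g1)); rewrite ler_piMl.
have h0 : eps ^+ 2 * g (y / beta) <= eps ^+ 2 * (beta / (beta - 1)).
  by rewrite ler_wpM2l// sqr_ge0.
lra.
Qed.

Lemma measurable_fun_ifr (R : realType) (f g h k : R -> R) :
  measurable_fun setT f -> measurable_fun setT g ->
  measurable_fun setT h -> measurable_fun setT k ->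
  measurable_fun setT (fun x => if f x < g x then h x else k x).
Proof.
by move=> mf mg mh mk; apply: measurable_fun_ifT => //; exact: measurable_fun_ltr.
Qed.

Lemma measurable_fun_ifle (R : realType) (f g h k : R -> R) :
  measurable_fun setT f -> measurable_fun setT g ->
  measurable_fun setT h -> measurable_fun setT k ->
  measurable_fun setT (fun x => if f x <= g x then h x else k x).
Proof.
by move=> mf mg mh mk; apply: measurable_fun_ifT => //; exact: measurable_fun_ler.
Qed.

Lemma measurable_parry_sum (R : realType) (beta : R) (N : nat) :
  measurable_fun setT (parry_sum beta N).
Proof.
apply: measurable_sum => n; apply: measurable_funM => //.
rewrite (_ : (fun y => _) = fun y => if y < greedy beta 1 n then 1 else 0).
  exact: measurable_fun_ifr.
by apply/funext => y; case: ifP.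
Qed.

Lemma measurable_capped_power (R : realType) (a : R) (s : nat) : 0 < a ->
  measurable_fun setT (capped_power a s).
Proof.
move=> a0; apply: measurable_funX.
apply: continuous_measurable_fun => x; apply: cvgV.
  by rewrite gt_eqF// lt_max a0 orbT.
by apply: continuous_max => //; exact: cvg_cst.
Qed.

Lemma measurable_potential (R : realType) (beta a delta eta : R) (N s : nat) :
  0 < a -> measurable_fun setT (potential beta a delta eta N s).
Proof.
move=> a0; apply: measurable_fun_ifr => //; apply: measurable_fun_ifr => //.
  apply: measurable_funB; first exact: measurable_parry_sum.
  by apply: measurable_funM => //; exact: measurable_capped_power.
exact: measurable_fun_ifle.
Qed.

Lemma measurable_digit0_weight (R : realType) (beta eps : R) :
  measurable_fun setT (digit0_weight beta eps).
Proof. by apply: measurable_fun_ifr => //; exact: measurable_fun_ifle. Qed.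

Lemma measurable_digit1_weight (R : realType) (beta eps : R) :
  measurable_fun setT (digit1_weight beta eps).
Proof.
apply: measurable_fun_ifr => //; apply: measurable_fun_ifle => //.
exact: measurable_funD.
Qed.

(** The parameters are chosen in the order [a], [s], [eps], then [delta] and [eta],
    then [N] and [rho].  The balance can be met because [delta] is of order [eps]
    while [eta] only has to be of order [eps ^+ 2]. *)
Lemma exists_potential (R : realType) (beta : R) : 1 < beta -> beta < 2 ->
  exists (eps rho m : R) (g : R -> R),
  [/\ 0 < rho < 1, 0 < m & measurable_fun setT g] /\
  [/\ forall y, 0 <= g y,
      exists K, forall y, g y <= K,
      forall y, y < 0 \/ (beta - 1)^-1 < y -> g y = 0,
      forall y, 0 <= y -> y <= (beta - 1)^-1 -> m <= g y &
      forall y, digit0_weight beta eps y * g (y / beta) +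
        digit1_weight beta eps y * g ((y + 1) / beta) <= beta * rho * g y].
Proof.
move=> b1 b2; have b0 : 0 < beta by lra.
have u0 : 0 < beta - 1 by lra.
have M1 : 1 < (beta - 1)^-1 by rewrite invf_gt1//; lra.
(* Any a satisfying the two conditions on beta * a would do; this one gives
   beta * a = (2 - beta) * (beta - 1). *)
pose a := (2 - beta) * (beta - 1) / beta.
have ba : beta * a = (2 - beta) * (beta - 1) by rewrite /a; field; rewrite gt_eqF.
have a0 : 0 < a by rewrite divr_gt0// mulr_gt0//; lra.
have [s hs] := exists_expr_gt (2 * beta) b1.
have V0 : 0 < a^-1 ^+ s by rewrite exprn_gt0// invr_gt0.
set V := a^-1 ^+ s in V0.
have V1 : 0 < 1 + V by lra.
have C0 : 0 < beta / (beta - 1) by rewrite divr_gt0.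
(* This eps makes eta = delta / 3 meet the balance on [1, (beta - 1)^-1], with
   equality when beta * rho - 1 = (beta - 1) / 2; the truncation error and the
   defect 1 - rho take the two other thirds of delta. *)
pose eps := (beta - 1) ^+ 2 / (6 * beta ^+ 2 * (1 + V)).
pose delta := eps / (beta * (1 + V)).
pose eta := delta / 3.
have e0 : 0 < eps by rewrite divr_gt0 ?mulr_gt0 ?exprn_gt0//; lra.
have d0 : 0 < delta by rewrite divr_gt0// mulr_gt0.
have eta0 : 0 < eta by rewrite divr_gt0.
have e6 : eps <= 1 / 6.
  rewrite /eps ler_pdivrMr; last by rewrite !mulr_gt0 ?exprn_gt0.
  have -> : 1 / 6 * (6 * beta ^+ 2 * (1 + V)) = beta ^+ 2 * (1 + V) by field.
  have bV : beta ^+ 2 <= beta ^+ 2 * (1 + V).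
    by rewrite ler_peMr ?exprn_ge0 ?(ltW b0)//; lra.
  by apply: le_trans bV; rewrite lerXn2r// ?nnegrE; lra.
have dV : beta * (1 + V) * delta = eps.
  by rewrite /delta; field; rewrite !gt_eqF.
have [N hN] := exists_expr_gt (3 / delta) b1.
have bN : beta ^- N.+1 <= delta / 3.
  have d3 : 0 < delta / 3 by exact: eta0.
  rewrite -[leRHS]invrK lef_pV2 ?posrE ?exprn_gt0 ?invr_gt0//.
  rewrite invf_div (le_trans (ltW hN))// exprS.
  by rewrite ler_peMl ?exprn_ge0 ?(ltW b0) ?(ltW b1).
pose kappa := Num.min ((beta - 1) / (2 * beta)) (delta / 3 / (beta / (beta - 1))).
have k0 : 0 < kappa.
  have k1 : 0 < (beta - 1) / (2 * beta) by apply: divr_gt0 => //; exact: mulr_gt0.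
  have k2 : 0 < delta / 3 / (beta / (beta - 1)) by exact: divr_gt0 eta0 C0.
  by rewrite lt_min k1 k2.
have k1 : beta * kappa <= (beta - 1) / 2.
  have : kappa <= (beta - 1) / (2 * beta) by rewrite ge_min lexx.
  rewrite -(ler_pM2l b0) => /le_trans; apply.
  by rewrite le_eqVlt; apply/orP; left; apply/eqP; field; rewrite gt_eqF.
have k2 : kappa * (beta / (beta - 1)) <= delta / 3.
  by rewrite -ler_pdivlMr// ge_min lexx orbT.
have k3 : kappa < 1 by nra.
pose g := potential beta a delta eta N.+1 s.
have m0 : 0 < Num.min (1 / 2) eta by rewrite lt_min eta0 divr_gt0.
have dV2 : delta * V <= 1 / 6 by nra.
have glo y : 0 <= y -> y <= (beta - 1)^-1 -> Num.min (1 / 2) eta <= g y.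
  move=> y0 yM; rewrite /g /potential ltNge y0 yM /= ge_min.
  case: ltP => y1; last by rewrite lexx orbT.
  have := parry_sum_ge1 N b0 y1.
  have : delta * capped_power a s y <= delta * V.
    by rewrite ler_wpM2l ?(ltW d0)//; exact: capped_power_le.
  by move=> *; apply/orP; left; lra.
have gout y : y < 0 \/ (beta - 1)^-1 < y -> g y = 0.
  rewrite /g /potential; case=> [->//|yM].
  rewrite [y < 0]ltNge (_ : 0 <= y)/=; last by lra.
  rewrite [y < 1]ltNge (_ : 1 <= y)/=; last by lra.
  by rewrite leNgt yM.
exists eps; exists (1 - kappa); exists (Num.min (1 / 2) eta); exists g.
split; split => //.
- by apply/andP; split; lra.
- exact: measurable_potential.
- move=> y; have [y0|y0] := ltP y 0; first by rewrite gout//; left.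
  have [yM|yM] := ltP (beta - 1)^-1 y; first by rewrite gout//; right.
  exact: le_trans (ltW m0) (glo _ y0 yM).
- exists (beta / (beta - 1) + eta) => y.
  apply: (le_trans (potential_le _ _ _ b0 a0 (ltW d0) (ltW eta0))).
  by rewrite lerD2r parry_sum_le.
- move=> y; apply: potential_transfer => //; try exact: ltW; try by lra.
  + by rewrite ba; nra.
  + rewrite ba -(ler_pM2r u0) mulVf ?gt_eqF//; nra.
  + by rewrite /eta; lra.
  + rewrite -/V dV//.
  + have -> : eps ^+ 2 * (beta / (beta - 1)) = eta * ((beta - 1) / 2).
      by rewrite /eta /delta /eps; field; rewrite !gt_eqF.
    by nra.
Qed.

(** * Integrals with respect to Lebesgue measure *)

(** Lebesgue measure is [beta] times its image under [x |-> beta * x + c], because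
    the two measures agree on half-open intervals. *)
Lemma ge0_integral_affine (R : realType) (beta c : R) (f : R -> R) :
  0 < beta -> measurable_fun setT f -> (forall x, 0 <= f x) ->
  (\int[lebesgue_measure]_x (f (beta * x + c))%:E =
   beta^-1%:E * \int[lebesgue_measure]_x (f x)%:E)%E.
Proof.
move=> b0 mf f0.
pose phi : R -> measurableTypeR R := fun x => beta * x + c.
have mphi : measurable_fun setT (phi : measurableTypeR R -> measurableTypeR R).
  apply: measurable_funD => //; exact: measurable_funM.
have bge0 : 0 <= beta by exact: ltW.
have EF : measurable_fun setT (EFin \o f) by exact/measurable_EFinP.
(* The image of a measure is a measure only for a measurable phi: this proof is
   the first argument of key. *)
have key A : measurable A ->
    lebesgue_measure A = mscale (NngNum bge0) (pushforward lebesgue_measure phi) A.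
  apply: lebesgue_measure_unique => _ [[p q] _ <-] /=.
  rewrite /mscale /= /pushforward.
  have -> : phi @^-1` `]p, q] = `](p - c) / beta, (q - c) / beta]%classic.
    apply/seteqP; split=> x /=; rewrite !in_itv /phi/=
      ltr_pdivrMr// ler_pdivlMr// ltrBlDr lerBrDr mulrC//.
  rewrite !lebesgue_measure_itv/= !lte_fin ltr_pM2r ?invr_gt0// ltrD2r.
  case: ifP => _; last by rewrite mule0.
  by rewrite -!EFinD -EFinM; congr EFin; field; rewrite gt_eqF.
rewrite [in RHS](eq_measure_integral _ (fun A mA _ => key mphi A mA)).
rewrite ge0_integral_mscale//; last by move=> x _; rewrite lee_fin.
rewrite /= ge0_integral_pushforward//; last by move=> x _; rewrite lee_fin.
by rewrite preimage_setT muleA -EFinM mulVf ?gt_eqF// mul1e.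
Qed.

Lemma integral_bounded_support_lty (R : realType) (g : R -> R) (K M : R) :
  measurable_fun setT g -> (forall y, 0 <= g y) -> (forall y, g y <= K) ->
  (forall y, y < 0 \/ M < y -> g y = 0) ->
  (\int[lebesgue_measure]_x (g x)%:E < +oo)%E.
Proof.
move=> mg g0 gK gout.
have K0 : 0 <= K by exact: le_trans (g0 0) (gK 0).
have mI : measurable `[0, M]%classic by exact: measurable_itv.
apply: (@le_lt_trans _ _ (\int[lebesgue_measure]_(x in setT)
    (K%:E * (\1_`[0, M] x)%:E))%E).
  apply: ge0_le_integral => //.
  - by move=> x _; rewrite lee_fin.
  - exact/measurable_EFinP.
  - by apply: measurable_funeM; apply/measurable_EFinP; exact: measurable_indic.
  - move=> x _; rewrite -EFinM lee_fin indicE.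
    case: (boolP (x \in _)) => [_|]; first by rewrite mulr1.
    rewrite notin_setE /= in_itv /= => /negP; rewrite negb_and -!ltNge => /orP xM.
    by rewrite gout// mulr0.
rewrite ge0_integralZl//; last exact/measurable_EFinP/measurable_indic.
rewrite integral_indic// setIT /= lebesgue_measure_itv/= lte_fin.
by case: ifP => _; rewrite ?mule0 ?ltry// -EFinD -EFinM ltry.
Qed.

Lemma markov_ge0 (R : realType) (f : R -> R) (a : R) :
  0 < a -> measurable_fun setT f -> (forall x, 0 <= f x) ->
  (a%:E * lebesgue_measure [set x | (a <= f x)%R] <=
   \int[lebesgue_measure]_x (f x)%:E)%E.
Proof.
move=> a0 mf f0.
have mEf : measurable_fun setT (EFin \o f) by exact/measurable_EFinP.
have := le_integral_abse lebesgue_measure measurableT mEf a0.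
rewrite setTI; under eq_integral do rewrite /= ger0_norm//.
rewrite (_ : [set x | _ ] = [set x | a <= f x])//.
by apply/seteqP; split=> x /=; rewrite lee_fin ger0_norm.
Qed.

Lemma nneseries_geometric_lty (R : realType) (a z : R) :
  0 <= a -> 0 < z -> z < 1 -> (\sum_(n <oo) (a * z ^+ n)%:E < +oo)%E.
Proof.
move=> a0 z0 z1.
have zn : `|z| < 1 by rewrite gtr0_norm.
apply: (@le_lt_trans _ _ (a / (1 - z))%:E); last exact: ltry.
apply: lime_le.
  by apply: is_cvg_nneseries => n _ _; rewrite lee_fin mulr_ge0// exprn_ge0// ltW.
apply: nearW => n; rewrite sumEFin lee_fin.
exact: (geometric_le_lim n a0 z0 zn).
Qed.

Lemma limn_einf_ge (R : realType) (u : nat -> \bar R) (l : \bar R) (N : nat) :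
  (forall n, (N <= n)%N -> l <= u n)%E -> (l <= limn_einf u)%E.
Proof.
move=> hu; rewrite limn_einf_lim; apply: lime_ge; first exact: is_cvg_einfs.
exists N => // n /= Nn; apply: le_ereal_inf_tmp => _ [k /= nk <-].
by apply: hu; exact: leq_trans nk.
Qed.

(** * Reciprocals of the counting function *)

(** With every choice of a digit made at random, 0 with probability [eps] and 1
    with probability [1 - eps], this is the sum over the admissible words of
    length [n] of their squared probabilities. *)
Fixpoint inv_count_bound {R : realType} (beta eps : R) (n : nat) (x : R) : R :=
  if n is n'.+1 then
    digit0_weight beta eps (beta * x) * inv_count_bound beta eps n' (beta * x) +
    digit1_weight beta eps (beta * x - 1) *
      inv_count_bound beta eps n' (beta * x - 1)
  else 1.

(** The Cauchy-Schwarz inequality for two terms; the difference of the two sides is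
    a square over a positive number. *)
Lemma inv_add_le (R : realFieldType) (e a b : R) : 0 < a -> 0 < b ->
  (a + b)^-1 <= e ^+ 2 / a + (1 - e) ^+ 2 / b.
Proof.
move=> a0 b0; have ab0 : 0 < a + b by exact: addr_gt0.
rewrite -subr_ge0 (_ : _ - _ = (e * b - (1 - e) * a) ^+ 2 / (a * b * (a + b))).
  by rewrite divr_ge0 ?sqr_ge0// !mulr_ge0// ltW.
by field; rewrite !gt_eqF.
Qed.

(** Every case of the induction is an instance of [beta_countS]: one digit where
    it is forced, and [inv_add_le] where both are possible. *)
Lemma inv_beta_count_le (R : realType) (beta eps : R) (n : nat) (x : R) :
  1 < beta -> beta < 2 -> 0 <= x -> x <= (beta - 1)^-1 ->
  (0 < beta_count beta x n)%N /\
  (beta_count beta x n)%:R^-1 <= inv_count_bound beta eps n x.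
Proof.
move=> b1 b2; have b0 : 0 < beta by lra.
have M1 : 1 < (beta - 1)^-1 by rewrite invf_gt1//; lra.
have bM : beta * (beta - 1)^-1 = (beta - 1)^-1 + 1.
  by field; rewrite subr_eq0 gt_eqF.
elim: n x => [|n IH] x x0 xM.
  have N0 := beta_count0_gt0 b1 b2 x0 xM; split => //=.
  by rewrite invf_le1 ?ltr0n// ler1n.
have := @beta_countS R beta x n b0.
set N' := beta_count beta x n.+1.
have bx0 : 0 <= beta * x by rewrite mulr_ge0// ltW.
have bxM : beta * x <= beta * (beta - 1)^-1 by rewrite ler_pM2l.
move=> NS.
have NSR : (beta_count beta (beta * x) n)%:R +
    (beta_count beta (beta * x - 1) n)%:R <= N'%:R :> R.
  by rewrite -natrD ler_nat.
have step (r : R) : 0 < r -> r <= N'%:R -> (0 < N')%N /\ N'%:R^-1 <= r^-1.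
  move=> r0 rN; have N0 : 0 < N'%:R :> R by exact: lt_le_trans rN.
  by split; [rewrite -(ltr_nat R)|rewrite lef_pV2 ?posrE].
have n0 y : 0 <= (beta_count beta y n)%:R :> R by exact: ler0n.
have := n0 (beta * x); have := n0 (beta * x - 1) => c1 c0 /=.
rewrite /digit0_weight /digit1_weight.
have [lt1|ge1] := ltP (beta * x) 1.
  rewrite (_ : beta * x - 1 < 0); last by lra.
  have [N0 NF] := IH (beta * x) bx0 (ltW (lt_trans lt1 M1)).
  rewrite mul0r addr0 mul1r.
  have [] := step (beta_count beta (beta * x) n)%:R; rewrite ?ltr0n//; first lra.
  by move=> N'0 h; split => //; exact: le_trans h NF.
rewrite (_ : (beta * x - 1 < 0) = false); last by lra.
have [N1 NF1] := IH (beta * x - 1) ltac:(lra) ltac:(lra).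
rewrite subrK; have [leM|gtM] := leP (beta * x) (beta - 1)^-1; last first.
  rewrite mul0r add0r mul1r.
  have [] := step (beta_count beta (beta * x - 1) n)%:R; rewrite ?ltr0n//.
    by lra.
  by move=> N'0 h; split => //; exact: le_trans h NF1.
have [N0 NF0] := IH (beta * x) bx0 leM.
have [] := step ((beta_count beta (beta * x) n)%:R +
  (beta_count beta (beta * x - 1) n)%:R) => //.
  by rewrite -natrD ltr0n addn_gt0 N0.
move=> N'0 h; split => //; apply: (le_trans h).
apply: (le_trans (@inv_add_le _ eps _ _ _ _)); rewrite ?ltr0n//.
by apply: lerD; rewrite ler_wpM2l ?sqr_ge0.
Qed.

Lemma digit0_weight_ge0 (R : realType) (beta eps y : R) :
  0 <= digit0_weight beta eps y.
Proof.
rewrite /digit0_weight; case: ifP => _ //; case: ifP => _ //; exact: sqr_ge0.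
Qed.

Lemma digit1_weight_ge0 (R : realType) (beta eps y : R) :
  0 <= digit1_weight beta eps y.
Proof.
rewrite /digit1_weight; case: ifP => _ //; case: ifP => _ //; exact: sqr_ge0.
Qed.

Lemma inv_count_bound_ge0 (R : realType) (beta eps : R) (n : nat) (x : R) :
  0 <= inv_count_bound beta eps n x.
Proof.
elim: n x => [|n IH] x //=.
by rewrite addr_ge0// mulr_ge0// ?digit0_weight_ge0 ?digit1_weight_ge0.
Qed.

Lemma measurable_inv_count_bound (R : realType) (beta eps : R) (n : nat) :
  measurable_fun setT (inv_count_bound beta eps n).
Proof.
elim: n => [|n IH]; first exact: measurable_cst.
have mb : measurable_fun setT (fun x : R => beta * x) by exact: mulrl_measurable.
have mb1 : measurable_fun setT (fun x : R => beta * x - 1).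
  exact: measurable_funB.
have m0 := @measurable_digit0_weight R beta eps.
have m1 := @measurable_digit1_weight R beta eps.
by apply: measurable_funD; apply: measurable_funM; exact: measurableT_comp.
Qed.

(** * Exponential decay and conclusion *)

(** Both terms of the recursion are composites with affine maps; the change of
    variables moves the operator from the bound to [g], where the hypothesis on
    [g] applies. *)
Lemma integral_inv_count_boundS (R : realType) (beta eps rho : R)
    (g : R -> R) (n : nat) :
  0 < beta -> 0 <= rho -> measurable_fun setT g -> (forall y, 0 <= g y) ->
  (forall y, digit0_weight beta eps y * g (y / beta) +
    digit1_weight beta eps y * g ((y + 1) / beta) <= beta * rho * g y) ->
  (\int[lebesgue_measure]_x (inv_count_bound beta eps n.+1 x * g x)%:E <=
   rho%:E * \int[lebesgue_measure]_x (inv_count_bound beta eps n x * g x)%:E)%E.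
Proof.
move=> b0 rho0 mg g0 hg.
set F := inv_count_bound beta eps n.
have mF : measurable_fun setT F by exact: measurable_inv_count_bound.
have F0 y : 0 <= F y by exact: inv_count_bound_ge0.
pose P0 y := digit0_weight beta eps y * F y * g (y / beta).
pose P1 y := digit1_weight beta eps y * F y * g ((y + 1) / beta).
have m0 := @measurable_digit0_weight R beta eps.
have m1 := @measurable_digit1_weight R beta eps.
have mP0 : measurable_fun setT P0.
  apply: measurable_funM; first exact: measurable_funM.
  by apply: measurableT_comp => //; exact: mulrr_measurable.
have mP1 : measurable_fun setT P1.
  apply: measurable_funM; first exact: measurable_funM.
  apply: measurableT_comp => //; apply: measurable_funM => //.
  exact: measurable_funD.
have P00 y : 0 <= P0 y by rewrite !mulr_ge0// digit0_weight_ge0.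
have P10 y : 0 <= P1 y by rewrite !mulr_ge0// digit1_weight_ge0.
have mb c : measurable_fun setT (fun x : R => beta * x + c).
  by apply: measurable_funD => //; exact: mulrl_measurable.
have split_step x : inv_count_bound beta eps n.+1 x * g x =
    P0 (beta * x + 0) + P1 (beta * x - 1).
  have xb : beta * x / beta = x by rewrite mulrC mulKf// gt_eqF.
  by rewrite /P0 /P1 addr0 subrK xb /= mulrDl.
under eq_integral do rewrite split_step EFinD.
rewrite ge0_integralD//; [|by move=> x _; rewrite lee_fin| |
  by move=> x _; rewrite lee_fin|]; last 2 first.
- by apply/measurable_EFinP; exact: (measurableT_comp mP0 (mb 0)).
- by apply/measurable_EFinP; exact: (measurableT_comp mP1 (mb (-1))).
rewrite !ge0_integral_affine//.
rewrite -ge0_muleDr ?integral_ge0//; do ?by move=> x _; rewrite lee_fin.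
rewrite -ge0_integralD//; do ?[by move=> x _; rewrite lee_fin |
  by apply/measurable_EFinP].
have -> : rho%:E = (beta^-1%:E * (beta * rho)%:E)%E :> \bar R.
  by rewrite -EFinM mulKf// gt_eqF.
rewrite -muleA lee_pmul2l ?lte_fin ?invr_gt0//.
have mFg : measurable_fun setT (fun x => (F x * g x)%:E).
  by apply/measurable_EFinP; exact: measurable_funM.
have Fg0 x : (0 <= (F x * g x)%:E)%E by rewrite lee_fin mulr_ge0.
rewrite -ge0_integralZl//; last by rewrite lee_fin mulr_ge0// ltW.
apply: ge0_le_integral => //.
- by move=> x _; rewrite -EFinD lee_fin addr_ge0.
- by apply: emeasurable_funD; exact/measurable_EFinP.
- exact: measurable_funeM.
- move=> x _; rewrite -EFinD -EFinM lee_fin /P0 /P1.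
  have := ler_wpM2l (F0 x) (hg x); lra.
Qed.

Lemma integral_inv_count_bound_le (R : realType) (beta eps rho : R)
    (g : R -> R) (n : nat) :
  0 < beta -> 0 <= rho -> measurable_fun setT g -> (forall y, 0 <= g y) ->
  (forall y, digit0_weight beta eps y * g (y / beta) +
    digit1_weight beta eps y * g ((y + 1) / beta) <= beta * rho * g y) ->
  (\int[lebesgue_measure]_x (inv_count_bound beta eps n x * g x)%:E <=
   (rho ^+ n)%:E * \int[lebesgue_measure]_x (g x)%:E)%E.
Proof.
move=> b0 r0 mg g0 hg; elim: n => [|n IH].
  by under eq_integral do rewrite /= mul1r; rewrite expr0 mul1e.
apply: (le_trans (integral_inv_count_boundS n b0 r0 mg g0 hg)).
by rewrite exprS EFinM -muleA lee_wpmul2l// lee_fin.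
Qed.

Theorem theorem4p1 (R : realType) (beta : R) (hbeta1 : 1 < beta)
    (hbeta2 : beta < 2) :
  exists c : R, 0 < c /\
    {ae (@lebesgue_measure R), forall x : R,
       0 < x -> x < (beta - 1)^-1 ->
       (c%:E <= limn_einf
          (fun n : nat => (ln (beta_count beta x n)%:R / n%:R)%:E))%E}.
Proof.
have b0 : 0 < beta by lra.
have [eps [rho [m [g [[/andP[r0 r1] m0 mg] [g0 [K gK] gout glo gtr]]]]]] :=
  exists_potential hbeta1 hbeta2.
pose F := inv_count_bound beta eps.
have F0 n x : 0 <= F n x by exact: inv_count_bound_ge0.
(* Half of the decay is spent in Markov's inequality: the set where the bound
   exceeds sigma ^+ n has measure of order (rho / sigma) ^+ n = sigma ^+ n. *)
set sigma := Num.sqrt rho.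
have s0 : 0 < sigma by rewrite sqrtr_gt0.
have s2 : sigma ^+ 2 = rho by rewrite sqr_sqrtr// ltW.
have s1 : sigma < 1 by rewrite -sqrtr1 ltr_sqrt.
exists (- ln sigma); split; first by rewrite oppr_gt0 ln_lt0// s0 s1.
pose E n := [set x | m * sigma ^+ n <= F n x * g x].
have mFg n : measurable_fun setT (fun x => F n x * g x).
  by apply: measurable_funM => //; exact: measurable_inv_count_bound.
have mE n : measurable (E n).
  rewrite -[X in measurable X]setTI.
  rewrite (_ : E n = (fun x => F n x * g x) @^-1` `[m * sigma ^+ n, +oo[).
    exact: mFg.
  by apply/seteqP; split=> x /=; rewrite in_itv/= andbT.
have gfin := integral_bounded_support_lty mg g0 gK gout.
pose A := fine (\int[lebesgue_measure]_x (g x)%:E)%E.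
have gge0 : (0 <= \int[lebesgue_measure]_x (g x)%:E)%E.
  by apply: integral_ge0 => x _; rewrite lee_fin.
have AE : (\int[lebesgue_measure]_x (g x)%:E)%E = A%:E.
  by rewrite fineK// ge0_fin_numE.
have A0 : 0 <= A by exact: fine_ge0.
have Ele n : (lebesgue_measure (E n) <= (A / m * sigma ^+ n)%:E)%E.
  have sn : 0 < sigma ^+ n by exact: exprn_gt0.
  have msn : 0 < m * sigma ^+ n by exact: mulr_gt0.
  have := markov_ge0 msn (mFg n) (fun x => mulr_ge0 (F0 n x) (g0 x)).
  have := integral_inv_count_bound_le n b0 (ltW r0) mg g0 gtr.
  rewrite AE -EFinM => le1 /le_trans /(_ le1).
  rewrite -[leRHS](_ : ((m * sigma ^+ n)%:E * (A / m * sigma ^+ n)%:E)%E = _).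
    by rewrite lee_pmul2l// lte_fin.
  rewrite -EFinM; congr EFin.
  by rewrite -s2 -exprM mulnC exprM expr2; field; rewrite gt_eqF.
exists (lim_sup_set E); split.
- by apply: bigcap_measurable => // n _; apply: bigcup_measurable => k _; exact: mE.
- apply: lim_sup_set_cvg0 => //.
  apply: (@le_lt_trans _ _ (\sum_(n <oo) (A / m * sigma ^+ n)%:E)%E).
    by apply: lee_nneseries => [n _ _|n _] //; exact: Ele.
  by apply: nneseries_geometric_lty => //; rewrite divr_ge0// ltW.
move=> x; apply: contra_notP => xE x0 xM.
have [N hN] : exists N, forall n, (N <= n)%N -> ~ E n x.
  apply: contrapT => hN; apply: xE => N _; apply: contrapT => hE.
  by apply: hN; exists N => n Nn En; apply: hE; exists n.
apply: (@limn_einf_ge _ _ _ N.+1) => n Nn.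
have n0 : (0 < n)%N by exact: leq_trans Nn.
rewrite lee_fin ler_pdivlMr ?ltr0n//.
have [c0 cF] := inv_beta_count_le eps n hbeta1 hbeta2 (ltW x0) (ltW xM).
have /negP := hN n (ltnW Nn); rewrite -ltNge => Fg.
have Fs : F n x < sigma ^+ n.
  rewrite -(ltr_pM2l m0) (le_lt_trans _ Fg)// mulrC ler_wpM2l//.
  by apply: glo; exact: ltW.
have Cs : sigma ^- n <= (beta_count beta x n)%:R.
  rewrite -[leRHS]invrK lef_pV2 ?posrE ?exprn_gt0 ?invr_gt0 ?ltr0n//.
  exact: le_trans cF (ltW Fs).
have sn : 0 < sigma ^- n by rewrite invr_gt0 exprn_gt0.
have : ln (sigma ^- n) <= ln (beta_count beta x n)%:R.
  by rewrite ler_ln// posrE ltr0n.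
by rewrite lnV ?posrE ?exprn_gt0// lnXn// mulNr mulr_natr.
Qed.
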